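(* Let $\Phi\subseteq\{I,O,U,\mathit{Self},Q_n,N_n\mid n\in\mathbb N\setminus\{0\}\}$ with $U\in\Phi$, and let $\mathcal T$ be a fuzzy TBox in $\mathcal L^{\sim}_\Phi$. For all fuzzy interpretations $\mathcal I$ and $\mathcal I'$ that are witnessed w.r.t. $\mathcal L^{\sim}_\Phi$ and strongly $\Phi$-bisimilar to each other, $\mathcal I\models\mathcal T$ iff $\mathcal I'\models\mathcal T$.
   Context: Gödel operations on $[0,1]$: $p\otimes q=\min\{p,q\}$, $p\oplus q=\max\{p,q\}$, $\ominus p=1$ if $p=0$ and $0$ otherwise, $(p\Rightarrow q)=1$ if $p\le q$ and $q$ otherwise, $(p\Leftrightarrow q)=(p\Rightarrow q)\otimes(q\Rightarrow p)$. Fix pairwise disjoint sets $\mathsf{CN}$, $\mathsf{RN}$, $\mathsf{IN}$ of concept, role and individual names. A basic role w.r.t. $\Phi$ is $r\in\mathsf{RN}$, or $r^-$ when $I\in\Phi$. Roles and concepts of $\mathcal L^{\sim}_\Phi$: each $r\in\mathsf{RN}$ is a role; if $R,S$ are roles and $C$ a concept then $R\circ S$, $R\sqcup S$, $R^*$, $C?$ are roles; $R^-$ if $I\in\Phi$; $U$ if $U\in\Phi$; concepts: $p\in[0,1]$, $A\in\mathsf{CN}$, $C\sqcap D$, $C\to D$, $\neg C$, $C\sqcup D$, $\mathord{\sim}C$, $\forall R.C$, $\exists R.C$; $\{a\}$ if $O\in\Phi$; $\exists r.\mathit{Self}$ if $\mathit{Self}\in\Phi$; ${\ge}n\,R.C$,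 ${<}n\,R.C$ for basic $R$ if $Q_n\in\Phi$; ${\ge}n\,R$, ${<}n\,R$ for basic $R$ if $N_n\in\Phi$. $\top$ is concept $1$. A fuzzy interpretation $\mathcal I$ has a nonempty domain $\Delta^{\mathcal I}$, $a^{\mathcal I}\in\Delta^{\mathcal I}$, $A^{\mathcal I}:\Delta^{\mathcal I}\to[0,1]$, $r^{\mathcal I}:(\Delta^{\mathcal I})^2\to[0,1]$, extended by: $U^{\mathcal I}\equiv1$; $(R^-)^{\mathcal I}(x,y)=R^{\mathcal I}(y,x)$; $(C?)^{\mathcal I}(x,y)=C^{\mathcal I}(x)$ if $x=y$, else $0$; $(R\circ S)^{\mathcal I}(x,y)=\sup_z R^{\mathcal I}(x,z)\otimes S^{\mathcal I}(z,y)$; $(R\sqcup S)^{\mathcal I}=R^{\mathcal I}\oplus S^{\mathcal I}$; $(R^* )^{\mathcal I}(x,y)=\sup\{\min(\{1\}\cup\{R^{\mathcal I}(x_i,x_{i+1})\mid i<n\})\mid n\ge0,x_0=x,x_n=y\}$; $p^{\mathcal I}(x)=p$; $\{a\}^{\mathcal I}(x)=1$ iff $x=a^{\mathcal I}$, else $0$; $(\neg C)^{\mathcal I}=\ominus C^{\mathcal I}$; $(\mathord{\sim}C)^{\mathcal I}(x)=1-C^{\mathcal I}(x)$; $\sqcap,\sqcup,\to$ pointwise by $\otimes,\oplus,\Rightarrow$; $(\exists r.\mathit{Self})^{\mathcal I}(x)=r^{\mathcal I}(x,x)$; $(\exists R.C)^{\mathcal I}(x)=\sup_y R^{\mathcal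 I}(x,y)\otimes C^{\mathcal I}(y)$; $(\forall R.C)^{\mathcal I}(x)=\inf_y(R^{\mathcal I}(x,y)\Rightarrow C^{\mathcal I}(y))$; $({\ge}n\,R.C)^{\mathcal I}(x)=\sup\{\min_i(R^{\mathcal I}(x,y_i)\otimes C^{\mathcal I}(y_i))\mid y_1..y_n$ pairwise distinct$\}$; $({<}n\,R.C)^{\mathcal I}(x)=\inf\{\min_i(R^{\mathcal I}(x,y_i)\otimes C^{\mathcal I}(y_i))\Rightarrow e\mid y_1..y_n\}$ with $e=1$ if some $y_j=y_k$ ($j<k$), else $0$; ${\ge}n\,R={\ge}n\,R.\top$, ${<}n\,R={<}n\,R.\top$. Witnessed w.r.t. $\mathcal L^{\sim}_\Phi$: for roles/concepts of $\mathcal L^{\sim}_\Phi$, every infinite set whose infimum (supremum) is taken above has a least (greatest) element. A fuzzy GCI in $\mathcal L^{\sim}_\Phi$ is $(C\sqsubseteq D)\rhd p$ with $C,D$ concepts of $\mathcal L^{\sim}_\Phi$, $\rhd\in\{\ge,>\}$, $p\in(0,1]$; $\mathcal I\models(C\sqsubseteq D)\rhd p$ iff $(C\to D)^{\mathcal I}(x)\rhd p$ for all $x$. A fuzzy TBox is a finite set of fuzzy GCIs; $\mathcal I\models\mathcal T$ iff it validates all of them. A crisp $\Phi$-bisimulation between $\mathcal I,\mathcal I'$ is $Z:\Delta^{\mathcal I}\times\Delta^{\mathcal I'}\to\{0,1\}$ such that, for all $x,x',A,a,r$ and basic $R$: (i) $Z(x,x')\le(A^{\mathcal I}(x)\Leftrightarrow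 A^{\mathcal I'}(x'))$; (ii) $\forall y\exists y'$: $Z(x,x')\otimes R^{\mathcal I}(x,y)\le Z(y,y')\otimes R^{\mathcal I'}(x',y')$; (iii) $\forall y'\exists y$: $Z(x,x')\otimes R^{\mathcal I'}(x',y')\le Z(y,y')\otimes R^{\mathcal I}(x,y)$; (iv) if $O\in\Phi$: $Z(x,x')=0$ whenever exactly one of $x=a^{\mathcal I}$, $x'=a^{\mathcal I'}$ holds; (v) if $U\in\Phi$: $\forall y\exists y'$ $Z(x,x')\le Z(y,y')$ and $\forall y'\exists y$ $Z(x,x')\le Z(y,y')$; (vi) if $\mathit{Self}\in\Phi$: $Z(x,x')\le(r^{\mathcal I}(x,x)\Leftrightarrow r^{\mathcal I'}(x',x'))$; (vii) if $Q_n\in\Phi$: if $Z(x,x')>0$ and $y_1..y_n$ pairwise distinct with all $R^{\mathcal I}(x,y_j)>0$, there exist pairwise distinct $y'_1..y'_n$ such that for each $i$ some $j$ has $Z(x,x')\otimes\bigotimes_k R^{\mathcal I}(x,y_k)\le Z(y_j,y'_i)\otimes R^{\mathcal I'}(x',y'_i)$, and symmetrically (from pairwise distinct $y'_1..y'_n$ with $R^{\mathcal I'}(x',y'_j)>0$ obtain pairwise distinct $y_1..y_n$ such that for each $i$ some $j$ has $Z(x,x')\otimes\bigotimes_k R^{\mathcal I'}(x',y'_k)\le Z(y_i,y'_j)\otimes R^{\mathcal I}(x,y_i)$); (viii) if $N_n\in\Phi$: as (vii) with right-hand sides $R^{\mathcal I'}(x',y'_i)$ for all $i$, resp. $R^{\mathcal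 I}(x,y_i)$ for all $i$. $\mathcal I$ and $\mathcal I'$ are strongly $\Phi$-bisimilar if $\mathsf{IN}\ne\emptyset$ and there is a crisp $\Phi$-bisimulation $Z$ between them with $Z(a^{\mathcal I},a^{\mathcal I'})=1$ for all $a\in\mathsf{IN}$. *)

(* Defs.v *)
From HB Require Import structures.
From mathcomp Require Import all_boot all_order all_algebra interval_inference.
From mathcomp Require Import boolp classical_sets cardinality reals.
Set Implicit Arguments.
Unset Strict Implicit.
Unset Printing Implicit Defensive.
Import Order.TTheory GRing.Theory Num.Theory.
Local Open Scope classical_set_scope.
Local Open Scope ring_scope.

(* The Goedel operations are given on R and only used on [0, 1]; the t-norm
   and the t-conorm are Num.min and Num.max. *)
Definition godel_neg (R : realType) (p : R) : R := if p == 0 then 1 else 0.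
Definition godel_imp (R : realType) (p q : R) : R := if p <= q then 1 else q.
Definition godel_iff (R : realType) (p q : R) : R :=
  Num.min (godel_imp p q) (godel_imp q p).

Inductive feature : Type :=
| FI | FO | FU | FSelf
| FQ (n : nat) of (0 < n)%N
| FN (n : nat) of (0 < n)%N.

(* The constructors that depend on a feature carry a proof that it belongs to
   Phi, so the inhabitants of [role] and [concept] are exactly the roles and
   concepts of the language determined by Phi. *)
Section Syntax.
Context (R : realType) (CN RN IN : Type) (Phi : set feature).

Inductive basic_role : Type :=
| BName of RN
| BInv of Phi FI & RN.

Inductive role : Type :=
| RName of RN
| RComp of role & role
| RUnion of role & role
| RStar of role
| RTest of concept
| RInv of Phi FI & role
| RUniv of Phi FU
with concept : Type :=
| CConst of {i01 R}
| CName of CN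
| CAnd of concept & concept
| CImp of concept & concept
| CNeg of concept
| COr of concept & concept
| CInvol of concept
| CAll of role & concept
| CEx of role & concept
| CNominal of Phi FO & IN
| CSelf of Phi FSelf & RN
| CGeQ (n : nat) (n_gt0 : (0 < n)%N) of Phi (FQ n_gt0) & basic_role & concept
| CLtQ (n : nat) (n_gt0 : (0 < n)%N) of Phi (FQ n_gt0) & basic_role & concept
| CGeN (n : nat) (n_gt0 : (0 < n)%N) of Phi (FN n_gt0) & basic_role
| CLtN (n : nat) (n_gt0 : (0 < n)%N) of Phi (FN n_gt0) & basic_role.

Inductive threshold : Type := AtLeast | GreaterThan.

Record gci : Type := GCI {
  gci_lhs : concept;
  gci_rhs : concept;
  gci_rel : threshold;
  gci_deg : {i01 R};
  gci_deg_gt0 : 0 < gci_deg%:num }.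

End Syntax.

(* IN may be empty, hence the separate nonemptiness field. *)
Record interp (R : realType) (CN RN IN : Type) : Type := Interp {
  dom : Type;
  dom_nonempty : inhabited dom;
  ind_interp : IN -> dom;
  cname_interp : CN -> dom -> {i01 R};
  rname_interp : RN -> dom -> dom -> {i01 R} }.

(* The sets of truth values over which suprema and infima are taken: f and g
   stand for interpretations of roles, c for that of a concept.  All values lie
   in [0, 1], so 1 is the neutral element of the iterated minima. *)
Section ValueSets.
Context (R : realType) (T : Type).

Definition comp_set (f g : T -> T -> R) (x y : T) : set R :=
  [set v | exists z, v = Num.min (f x z) (g z y)].

(* The path x_0, ..., x_n is the initial segment of s : nat -> T. *)
Definition star_set (f : T -> T -> R) (x y : T) : set R :=
  [set v | exists (n : nat) (s : nat -> T),
     [/\ s 0%N = x, s n = y & v = \big[Num.min/1]_(i < n) f (s i) (s i.+1)]].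

Definition ex_set (f : T -> T -> R) (c : T -> R) (x : T) : set R :=
  [set v | exists y, v = Num.min (f x y) (c y)].

Definition all_set (f : T -> T -> R) (c : T -> R) (x : T) : set R :=
  [set v | exists y, v = godel_imp (f x y) (c y)].

Definition ge_set (n : nat) (f : T -> T -> R) (c : T -> R) (x : T) : set R :=
  [set v | exists2 y : 'I_n -> T, injective y &
     v = \big[Num.min/1]_(i < n) Num.min (f x (y i)) (c (y i))].

Definition lt_set (n : nat) (f : T -> T -> R) (c : T -> R) (x : T) : set R :=
  [set v | exists y : 'I_n -> T,
     v = godel_imp
           (\big[Num.min/1]_(i < n) Num.min (f x (y i)) (c (y i)))
           (if `[< exists j k : 'I_n, (j < k)%N /\ y j = y k >] then 1 else 0)].

End ValueSets.

Section Semantics.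
Context (R : realType) (CN RN IN : Type) (Phi : set feature).
Context (I : interp R CN RN IN).
Implicit Types x y : dom I.

Definition basic_interp (B : basic_role RN Phi) x y : R :=
  match B with
  | BName r => (rname_interp r x y)%:num
  | BInv _ r => (rname_interp r y x)%:num
  end.

(* [sup] and [inf] are total on [set R].  The sets below are bounded, and
   nonempty except possibly [ge_set], for which sup set0 = 0 is the supremum
   of the empty set in [0, 1]. *)
Fixpoint role_interp (P : role R CN RN IN Phi) : dom I -> dom I -> R :=
  match P with
  | RName r => fun x y => (rname_interp r x y)%:num
  | RComp P1 P2 => fun x y => sup (comp_set (role_interp P1) (role_interp P2) x y)
  | RUnion P1 P2 => fun x y => Num.max (role_interp P1 x y) (role_interp P2 x y)
  | RStar P1 => fun x y => sup (star_set (role_interp P1) x y)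
  | RTest C => fun x y => if `[< x = y >] then concept_interp C x else 0
  | RInv _ P1 => fun x y => role_interp P1 y x
  | RUniv _ => fun _ _ => 1
  end
with concept_interp (C : concept R CN RN IN Phi) : dom I -> R :=
  match C with
  | CConst p => fun _ => p%:num
  | CName A => fun x => (cname_interp A x)%:num
  | CAnd C1 C2 => fun x => Num.min (concept_interp C1 x) (concept_interp C2 x)
  | CImp C1 C2 => fun x => godel_imp (concept_interp C1 x) (concept_interp C2 x)
  | CNeg C1 => fun x => godel_neg (concept_interp C1 x)
  | COr C1 C2 => fun x => Num.max (concept_interp C1 x) (concept_interp C2 x)
  | CInvol C1 => fun x => 1 - concept_interp C1 x
  | CAll P C1 => fun x => inf (all_set (role_interp P) (concept_interp C1) x)
  | CEx P C1 => fun x => sup (ex_set (role_interp P) (concept_interp C1) x)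
  | CNominal _ a => fun x => if `[< x = ind_interp I a >] then 1 else 0
  | CSelf _ r => fun x => (rname_interp r x x)%:num
  | @CGeQ _ _ _ _ _ n _ _ B C1 => fun x =>
      sup (ge_set n (basic_interp B) (concept_interp C1) x)
  | @CLtQ _ _ _ _ _ n _ _ B C1 => fun x =>
      inf (lt_set n (basic_interp B) (concept_interp C1) x)
  | @CGeN _ _ _ _ _ n _ _ B => fun x => sup (ge_set n (basic_interp B) (fun=> 1) x)
  | @CLtN _ _ _ _ _ n _ _ B => fun x => inf (lt_set n (basic_interp B) (fun=> 1) x)
  end.

Definition role_of_basic (B : basic_role RN Phi) : role R CN RN IN Phi :=
  match B with
  | BName r => RName _ _ _ _ r
  | BInv h r => RInv h (RName _ _ _ _ r)
  end.

Lemma role_interp_basic (B : basic_role RN Phi) :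
  role_interp (role_of_basic B) = basic_interp B.
Proof. by case: B. Qed.

Definition gci_holds (g : gci R CN RN IN Phi) : Prop :=
  forall x,
    let v := concept_interp (CImp (gci_lhs g) (gci_rhs g)) x in
    match gci_rel g with
    | AtLeast => v >= (gci_deg g)%:num
    | GreaterThan => v > (gci_deg g)%:num
    end.

Definition tbox_holds (Tb : set (gci R CN RN IN Phi)) : Prop :=
  forall g, Tb g -> gci_holds g.

End Semantics.

Definition sup_witnessed (R : realType) (A : set R) : Prop :=
  infinite_set A -> (A `&` ubound A) !=set0.
Definition inf_witnessed (R : realType) (A : set R) : Prop :=
  infinite_set A -> (A `&` lbound A) !=set0.

Record witnessed (R : realType) (CN RN IN : Type) (Phi : set feature)
    (I : interp R CN RN IN) : Prop := Witnessed {
  witnessed_comp : forall (P1 P2 : role R CN RN IN Phi) (x y : dom I),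
    sup_witnessed (comp_set (role_interp P1) (role_interp P2) x y);
  witnessed_star : forall (P : role R CN RN IN Phi) (x y : dom I),
    sup_witnessed (star_set (role_interp P) x y);
  witnessed_all : forall (P : role R CN RN IN Phi) (C : concept R CN RN IN Phi)
      (x : dom I),
    inf_witnessed (all_set (role_interp P) (concept_interp C) x);
  witnessed_ex : forall (P : role R CN RN IN Phi) (C : concept R CN RN IN Phi)
      (x : dom I),
    sup_witnessed (ex_set (role_interp P) (concept_interp C) x);
  witnessed_geQ : forall (n : nat) (n_gt0 : (0 < n)%N), Phi (FQ n_gt0) ->
    forall (B : basic_role RN Phi) (C : concept R CN RN IN Phi) (x : dom I),
    sup_witnessed (ge_set n (basic_interp B) (concept_interp C) x);
  witnessed_ltQ : forall (n : nat) (n_gt0 : (0 < n)%N), Phi (FQ n_gt0) ->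
    forall (B : basic_role RN Phi) (C : concept R CN RN IN Phi) (x : dom I),
    inf_witnessed (lt_set n (basic_interp B) (concept_interp C) x);
  witnessed_geN : forall (n : nat) (n_gt0 : (0 < n)%N), Phi (FN n_gt0) ->
    forall (B : basic_role RN Phi) (x : dom I),
    sup_witnessed (ge_set n (basic_interp B) (fun=> 1 : R) x);
  witnessed_ltN : forall (n : nat) (n_gt0 : (0 < n)%N), Phi (FN n_gt0) ->
    forall (B : basic_role RN Phi) (x : dom I),
    inf_witnessed (lt_set n (basic_interp B) (fun=> 1 : R) x) }.

(* Z takes its values in {0, 1} = bool, embedded in R by b |-> b%:R. *)
Record crisp_bisim (R : realType) (CN RN IN : Type) (Phi : set feature)
    (I I' : interp R CN RN IN) (Z : dom I -> dom I' -> bool) : Prop := CrispBisim {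
  bisim_cname : forall x x' (A : CN),
    (Z x x')%:R <= godel_iff (cname_interp A x)%:num (cname_interp A x')%:num;
  bisim_forth : forall x x' (B : basic_role RN Phi) y, exists y',
    Num.min (Z x x')%:R (basic_interp B x y)
      <= Num.min (Z y y')%:R (basic_interp B x' y');
  bisim_back : forall x x' (B : basic_role RN Phi) y', exists y,
    Num.min (Z x x')%:R (basic_interp B x' y')
      <= Num.min (Z y y')%:R (basic_interp B x y);
  bisim_nominal : Phi FO -> forall x x' (a : IN),
    (x = ind_interp I a /\ x' <> ind_interp I' a) \/
    (x <> ind_interp I a /\ x' = ind_interp I' a) ->
    Z x x' = false;
  bisim_univ_forth : Phi FU -> forall x x' y, exists y',
    (Z x x')%:R <= (Z y y')%:R :> R;
  bisim_univ_back : Phi FU -> forall x x' y', exists y,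
    (Z x x')%:R <= (Z y y')%:R :> R;
  bisim_self : Phi FSelf -> forall x x' (r : RN),
    (Z x x')%:R <= godel_iff (rname_interp r x x)%:num (rname_interp r x' x')%:num;
  bisim_Q_forth : forall (n : nat) (n_gt0 : (0 < n)%N), Phi (FQ n_gt0) ->
    forall x x' (B : basic_role RN Phi) (y : 'I_n -> dom I),
    0 < (Z x x')%:R :> R -> injective y -> (forall j, 0 < basic_interp B x (y j)) ->
    exists2 y' : 'I_n -> dom I', injective y' &
      forall i, exists j,
        Num.min (Z x x')%:R (\big[Num.min/1]_(k < n) basic_interp B x (y k))
          <= Num.min (Z (y j) (y' i))%:R (basic_interp B x' (y' i));
  bisim_Q_back : forall (n : nat) (n_gt0 : (0 < n)%N), Phi (FQ n_gt0) ->
    forall x x' (B : basic_role RN Phi) (y' : 'I_n -> dom I'),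
    0 < (Z x x')%:R :> R -> injective y' -> (forall j, 0 < basic_interp B x' (y' j)) ->
    exists2 y : 'I_n -> dom I, injective y &
      forall i, exists j,
        Num.min (Z x x')%:R (\big[Num.min/1]_(k < n) basic_interp B x' (y' k))
          <= Num.min (Z (y i) (y' j))%:R (basic_interp B x (y i));
  bisim_N_forth : forall (n : nat) (n_gt0 : (0 < n)%N), Phi (FN n_gt0) ->
    forall x x' (B : basic_role RN Phi) (y : 'I_n -> dom I),
    0 < (Z x x')%:R :> R -> injective y -> (forall j, 0 < basic_interp B x (y j)) ->
    exists2 y' : 'I_n -> dom I', injective y' &
      forall i,
        Num.min (Z x x')%:R (\big[Num.min/1]_(k < n) basic_interp B x (y k))
          <= basic_interp B x' (y' i);
  bisim_N_back : forall (n : nat) (n_gt0 : (0 < n)%N), Phi (FN n_gt0) ->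
    forall x x' (B : basic_role RN Phi) (y' : 'I_n -> dom I'),
    0 < (Z x x')%:R :> R -> injective y' -> (forall j, 0 < basic_interp B x' (y' j)) ->
    exists2 y : 'I_n -> dom I, injective y &
      forall i,
        Num.min (Z x x')%:R (\big[Num.min/1]_(k < n) basic_interp B x' (y' k))
          <= basic_interp B x (y i) }.

Definition strongly_bisimilar (R : realType) (CN RN IN : Type) (Phi : set feature)
    (I I' : interp R CN RN IN) : Prop :=
  inhabited IN /\
  exists Z : dom I -> dom I' -> bool,
    crisp_bisim Phi Z /\ forall a : IN, Z (ind_interp I a) (ind_interp I' a) = true.

(* Main.v *)
(** A crisp bisimulation [Z] leaves every concept invariant: by mutual
    induction, related points give equal values to each concept, and each role
    [f] is simulated in both directions, i.e. from [Z x x'] every [y] has some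
    [y'] with [Z y y'] and [f x y <= f' x' y'].  The universal role supplies a
    related [y'] even when [f x y = 0].  For compositions and iterations the
    witness condition makes the supremum a maximum, so that a single optimal
    path can be copied step by step.  With inverse roles in the language, the
    induction also carries the simulation of the converse of each role.  Finally
    the universal role relates every point of one domain to a point of the
    other, starting from any named individual. *)
Require Import Defs.
From mathcomp Require Import all_boot all_order all_algebra interval_inference.
From mathcomp Require Import boolp classical_sets cardinality reals.

Set Implicit Arguments.
Unset Strict Implicit.
Unset Printing Implicit Defensive.
Import Order.TTheory GRing.Theory Num.Theory.
Local Open Scope classical_set_scope.
Local Open Scope ring_scope.

(* Tests put concepts inside roles and quantifiers put roles inside concepts, so every induction has
   to run over both at once. *)
Scheme role_mut_ind := Induction for role Sort Prop
with concept_mut_ind := Induction for concept Sort Prop.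
Combined Scheme role_concept_ind from role_mut_ind, concept_mut_ind.

(** * Goedel implication and equivalence *)

Section Goedel.
Context {R : realType}.
Implicit Types p q : R.

Lemma num_itv01 (p : {i01 R}) : 0 <= (p%:num : R) <= 1.
Proof. by apply/andP; split; [exact: ge0|exact: le1]. Qed.

(** The bound [q' <= 1] covers the case where the right side has jumped to 1 while the left side is
    still [q']. *)
Lemma godel_imp_le p p' q q' :
  p <= p' -> q' <= q -> q' <= 1 -> godel_imp p' q' <= godel_imp p q.
Proof.
rewrite /godel_imp => pp' q'q q'1.
case: (leP p' q') => [p'q'|_]; last by case: ifP.
by rewrite (le_trans pp' (le_trans p'q' q'q)).
Qed.

Lemma godel_imp_ge0 p q : 0 <= q -> 0 <= godel_imp p q.
Proof. by rewrite /godel_imp; case: ifP. Qed.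

Lemma godel_imp_le1 p q : q <= 1 -> godel_imp p q <= 1.
Proof. by rewrite /godel_imp; case: ifP. Qed.

(** If the values differed, one of the two implications would equal the smaller value, which would
    then be at least 1. *)
Lemma godel_iff_eq p q : p <= 1 -> q <= 1 -> 1 <= godel_iff p q -> p = q.
Proof.
rewrite /godel_iff /godel_imp le_min => p1 q1 /andP[].
case: (leP p q) => [pq _|qp q_ge1].
  case: (leP q p) => [qp _|_ p_ge1]; apply/le_anti; first by rewrite pq qp.
  by rewrite pq (le_trans q1).
by move: (le_lt_trans q_ge1 qp); rewrite ltNge p1.
Qed.

Lemma godel_iffC p q : godel_iff p q = godel_iff q p.
Proof. exact: minC. Qed.

End Goedel.

(** * Suprema and infima of subsets of [0, 1] *)

Section SupInf.
Context {R : realType}.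
Implicit Types A : set R.

Lemma sup_itv01 A : (forall v, A v -> 0 <= v <= 1) -> 0 <= sup A <= 1.
Proof.
move=> A01; have [->|/set0P[v Av]] := eqVneq A set0; first by rewrite sup0 lexx ler01.
have A1 : ubound A 1 by move=> w /A01/andP[].
rewrite ge_sup ?andbT//; last by exists v.
by apply: le_trans (ub_le_sup _ Av); [case/andP: (A01 _ Av) | exists 1].
Qed.

Lemma inf_itv01 A : A !=set0 -> (forall v, A v -> 0 <= v <= 1) -> 0 <= inf A <= 1.
Proof.
move=> [v Av] A01; have A0 : lbound A 0 by move=> w /A01/andP[].
rewrite lb_le_inf//=; last by exists v.
by apply: le_trans (ge_inf _ Av) _; [exists 0 | case/andP: (A01 _ Av)].
Qed.

Lemma seq_has_max (v : R) (s : seq R) :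
  exists2 m, m \in v :: s & forall w, w \in v :: s -> w <= m.
Proof.
elim: s v => [|u s IH] v; first by exists v => [|w]; rewrite !inE// => /eqP->.
have [m ms m_max] := IH u; have [vm|mv] := leP v m.
  exists m; first by rewrite inE ms orbT.
  by move=> w; rewrite inE => /predU1P[->//|/m_max].
exists v; first by rewrite mem_head.
by move=> w; rewrite inE => /predU1P[->//|/m_max /le_trans->//]; exact: ltW.
Qed.

(** Being witnessed only concerns infinite sets; a finite nonempty set has a greatest element
    anyway. *)
Lemma sup_witnessed_attained A : A !=set0 -> sup_witnessed A -> A (sup A).
Proof.
move=> A0 Awit; suff [m [Am mA]] : A `&` ubound A !=set0.
  suff -> : sup A = m by [].
  by apply/le_anti; rewrite ge_sup//= ub_le_sup//; exists m.
have [fA|/Awit//] := pselect (finite_set A).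
have /finite_seqP[[|v s] As] := fA; first by case: A0 => x; rewrite As.
have [m ms m_max] := seq_has_max v s.
by exists m; rewrite As.
Qed.

End SupInf.

(** * Converses of composition, iteration and test *)

Definition conv {R T : Type} (f : T -> T -> R) : T -> T -> R := fun x y => f y x.

Section Converse.
Context {R : realType} {T : Type}.
Implicit Types f g : T -> T -> R.

Lemma comp_set_conv f g x y : comp_set f g x y = comp_set (conv g) (conv f) y x.
Proof. by apply/seteqP; split=> v [z ->]; exists z; exact: minC. Qed.

Lemma star_set_sub_conv f x y : star_set f x y `<=` star_set (conv f) y x.
Proof.
move=> v [n [s [sx sy ->]]]; exists n, (fun i => s (n - i)%N).
rewrite subn0 subnn; split=> //.
(* Edge [i] of the reversed path is edge [n - i.+1] of the original one, whose endpoint has index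
   [(n - i.+1).+1 = n - i]. *)
rewrite (reindex_inj rev_ord_inj) /=; apply: eq_bigr => i _.
by rewrite /conv -subSn// subSS.
Qed.

Lemma star_set_conv f x y : star_set f x y = star_set (conv f) y x.
Proof. by apply/seteqP; split; exact: star_set_sub_conv. Qed.

Lemma test_conv (c : T -> R) :
  conv (fun x y => if `[< x = y >] then c x else 0)
  = fun x y => if `[< x = y >] then c x else 0.
Proof.
apply/funext => x; apply/funext => y; rewrite /conv.
by case: asboolP => [->|yx]; [rewrite asboolT|rewrite asboolF// => /esym].
Qed.

End Converse.

(** * Value sets lie in [0, 1] *)

Section ValueSetBounds.
Context {R : realType} {T : Type}.
Variables (f g : T -> T -> R) (c : T -> R).
Hypotheses (f01 : forall x y, 0 <= f x y <= 1) (g01 : forall x y, 0 <= g x y <= 1).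
Hypothesis c01 : forall x, 0 <= c x <= 1.

Lemma min_itv01 (p q : R) : 0 <= p <= 1 -> 0 <= q <= 1 -> 0 <= Num.min p q <= 1.
Proof. by move=> /andP[p0 p1] /andP[q0 q1]; rewrite le_min ge_min p0 q0 p1. Qed.

Lemma max_itv01 (p q : R) : 0 <= p <= 1 -> 0 <= q <= 1 -> 0 <= Num.max p q <= 1.
Proof. by move=> /andP[p0 p1] /andP[q0 q1]; rewrite le_max ge_max p0 p1. Qed.

Lemma bigmin_itv01 (n : nat) (F : 'I_n -> R) :
  (forall i, 0 <= F i <= 1) -> 0 <= \big[Num.min/1]_(i < n) F i <= 1.
Proof.
move=> F01; rewrite bigmin_le_id andbT le_bigmin// => i _.
by case/andP: (F01 i).
Qed.

Lemma godel_imp_itv01 (p q : R) : 0 <= q <= 1 -> 0 <= godel_imp p q <= 1.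
Proof. by case/andP=> q0 q1; rewrite godel_imp_ge0 ?godel_imp_le1. Qed.

Lemma comp_set_itv01 x y v : comp_set f g x y v -> 0 <= v <= 1.
Proof. by move=> [z ->]; exact: min_itv01. Qed.

Lemma star_set_itv01 x y v : star_set f x y v -> 0 <= v <= 1.
Proof. by move=> [n [s [_ _ ->]]]; exact: bigmin_itv01. Qed.

Lemma ex_set_itv01 x v : ex_set f c x v -> 0 <= v <= 1.
Proof. by move=> [y ->]; exact: min_itv01. Qed.

Lemma all_set_itv01 x v : all_set f c x v -> 0 <= v <= 1.
Proof. by move=> [y ->]; exact: godel_imp_itv01. Qed.

Lemma ge_set_itv01 n x v : ge_set n f c x v -> 0 <= v <= 1.
Proof. by move=> [y _ ->]; apply: bigmin_itv01 => i; exact: min_itv01. Qed.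

Lemma lt_set_itv01 n x v : lt_set n f c x v -> 0 <= v <= 1.
Proof.
move=> [y ->]; apply: godel_imp_itv01.
by case: ifP => _; rewrite ?lexx ler01 ?lexx.
Qed.

End ValueSetBounds.

(** * Nonemptiness of value sets *)

Section Nonempty.
Context {R : realType} {T : Type}.
Implicit Types (f g : T -> T -> R) (c : T -> R) (x y : T).

Lemma comp_set_nonempty f g x y : comp_set f g x y !=set0.
Proof. by eexists; exists x. Qed.

Lemma star_set_nonempty f x y : star_set f x y !=set0.
Proof. by eexists; exists 1%N, (fun i => if i is 0%N then x else y); split. Qed.

Lemma ex_set_nonempty f c x : ex_set f c x !=set0.
Proof. by eexists; exists x. Qed.

Lemma all_set_nonempty f c x : all_set f c x !=set0.
Proof. by eexists; exists x. Qed.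

Lemma lt_set_nonempty n f c x : lt_set n f c x !=set0.
Proof. by eexists; exists (fun=> x). Qed.

End Nonempty.

(** * Truth values of roles and concepts lie in [0, 1] *)

Section InterpBounds.
Context {R : realType} {CN RN IN : Type} {Phi : set feature}.
Variable I : interp R CN RN IN.

Lemma basic_interp_itv01 (B : basic_role RN Phi) (x y : dom I) :
  0 <= basic_interp B x y <= 1.
Proof. by case: B => *; exact: num_itv01. Qed.

Lemma interp_itv01 :
  (forall (P : role R CN RN IN Phi) (x y : dom I), 0 <= role_interp P x y <= 1) /\
  (forall (C : concept R CN RN IN Phi) (x : dom I), 0 <= concept_interp C x <= 1).
Proof.
apply: role_concept_ind => /=.
- by move=> r x y; exact: num_itv01.
- move=> P IHP Q IHQ x y; apply: sup_itv01 => v; exact: comp_set_itv01.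
- by move=> P IHP Q IHQ x y; exact: max_itv01.
- move=> P IHP x y; apply: sup_itv01 => v; exact: star_set_itv01.
- by move=> C IHC x y; case: ifP => // _; rewrite lexx ler01.
- by move=> h P IHP x y.
- by move=> h x y; rewrite ler01 lexx.
- by move=> p x; exact: num_itv01.
- by move=> A x; exact: num_itv01.
- by move=> C IHC D IHD x; exact: min_itv01.
- by move=> C IHC D IHD x; exact: godel_imp_itv01.
- by move=> C IHC x; rewrite /godel_neg; case: ifP => _; rewrite lexx ler01.
- by move=> C IHC D IHD x; exact: max_itv01.
- by move=> C IHC x; rewrite subr_ge0 lerBlDr lerDl andbC.
- move=> P IHP C IHC x; apply: inf_itv01; first exact: all_set_nonempty.
  by move=> v; exact: all_set_itv01.
- move=> P IHP C IHC x; apply: sup_itv01 => v; exact: ex_set_itv01.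
- by move=> h a x; case: ifP => _; rewrite lexx ler01.
- by move=> h r x; exact: num_itv01.
- move=> n n_gt0 h B C IHC x; apply: sup_itv01 => v.
  by apply: ge_set_itv01 => //; exact: basic_interp_itv01.
- move=> n n_gt0 h B C IHC x; apply: inf_itv01; first exact: lt_set_nonempty.
  by move=> v; exact: lt_set_itv01.
- move=> n n_gt0 h B x; apply: sup_itv01 => v.
  apply: ge_set_itv01 => [y z|y]; first exact: basic_interp_itv01.
  by rewrite ler01 lexx.
- move=> n n_gt0 h B x; apply: inf_itv01; first exact: lt_set_nonempty.
  by move=> v; exact: lt_set_itv01.
Qed.

Lemma role_interp_itv01 (P : role R CN RN IN Phi) (x y : dom I) :
  0 <= role_interp P x y <= 1.
Proof. exact: interp_itv01.1. Qed.

Lemma concept_interp_itv01 (C : concept R CN RN IN Phi) (x : dom I) :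
  0 <= concept_interp C x <= 1.
Proof. exact: interp_itv01.2. Qed.

End InterpBounds.

(** * Simulation of fuzzy relations along a crisp relation *)

Section Simulation.
Context {R : realType} {T T' : Type}.
Variable Z : T -> T' -> bool.

(** Stronger than the forth clause of a bisimulation: a related [y'] is demanded even when
    [f x y = 0], so that simulations can be chained. *)
Definition simulates (f : T -> T -> R) (f' : T' -> T' -> R) : Prop :=
  forall x x' y, Z x x' -> exists2 y', Z y y' & f x y <= f' x' y'.

Lemma simulates_comp (f g : T -> T -> R) (f' g' : T' -> T' -> R) :
  (forall x y, 0 <= f' x y <= 1) -> (forall x y, 0 <= g' x y <= 1) ->
  (forall x y, sup_witnessed (comp_set f g x y)) ->
  simulates f f' -> simulates g g' ->
  simulates (fun x y => sup (comp_set f g x y))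
            (fun x y => sup (comp_set f' g' x y)).
Proof.
move=> f'01 g'01 wit ff' gg' x x' y Zxx'.
(* The answer [y'] depends on the intermediate point [z], yet one [y'] must serve the whole
   supremum; hence an optimal [z] is fixed first. *)
have [z ->] := sup_witnessed_attained (comp_set_nonempty f g x y) (wit x y).
have [z' Zzz' fz] := ff' _ _ z Zxx'; have [y' Zyy' gy] := gg' _ _ y Zzz'.
exists y' => //; apply: (@le_trans _ _ (Num.min (f' x' z') (g' z' y'))).
  exact: le_min2.
apply: ub_le_sup; last by exists z'.
by exists 1 => v /(comp_set_itv01 f'01 g'01)/andP[].
Qed.

Lemma simulates_path (f : T -> T -> R) (f' : T' -> T' -> R)
    (s : nat -> T) (x' : T') :
  simulates f f' -> Z (s 0%N) x' ->
  exists s' : nat -> T', [/\ s' 0%N = x', forall i, Z (s i) (s' i) &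
    forall i, f (s i) (s i.+1) <= f' (s' i) (s' i.+1)].
Proof.
move=> ff' Zx'.
(* Choice is made over all triples to get a total function [h]; on unrelated pairs the answer is a
   dummy. Iterating [h] along [s] gives the copy [s']. *)
have /choice[h hP] : forall t : T * T' * T, exists y' : T', Z t.1.1 t.1.2 ->
    Z t.2 y' /\ f t.1.1 t.2 <= f' t.1.2 y'.
  move=> [[x w'] y]; have [Zxw'|nZ] := boolP (Z x w'); last by exists w' => /= /idPn.
  by have [y' Zyy' fy] := ff' _ _ y Zxw'; exists y'.
pose s' := fix s' i := if i is j.+1 then h (s j, s' j, s j.+1) else x'.
have Zs' i : Z (s i) (s' i) by elim: i => //= i /(hP (s i, s' i, s i.+1))[].
exists s'; split=> // i; by have [] := hP (s i, s' i, s i.+1) (Zs' i).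
Qed.

Lemma simulates_star (f : T -> T -> R) (f' : T' -> T' -> R) :
  (forall x y, sup_witnessed (star_set f x y)) ->
  simulates f f' ->
  simulates (fun x y => sup (star_set f x y)) (fun x y => sup (star_set f' x y)).
Proof.
move=> wit ff' x x' y Zxx'.
have [n [s [sx sy ->]]] :=
  sup_witnessed_attained (star_set_nonempty f x y) (wit x y).
rewrite -sx in Zxx'; have [s' [s'x' Zs' fs]] := simulates_path ff' Zxx'.
exists (s' n); first by rewrite -sy.
apply: (@le_trans _ _ (\big[Num.min/1]_(i < n) f' (s' i) (s' i.+1))).
  exact: le_bigmin2.
apply: ub_le_sup; last by exists n, s'.
by exists 1 => v [m [t [_ _ ->]]]; exact: bigmin_le_id.
Qed.

(** Only the larger of the two values has to be matched, so [y'] comes from that one relation. *)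
Lemma simulates_max (f g : T -> T -> R) (f' g' : T' -> T' -> R) :
  simulates f f' -> simulates g g' ->
  simulates (fun x y => Num.max (f x y) (g x y))
            (fun x y => Num.max (f' x y) (g' x y)).
Proof.
move=> ff' gg' x x' y Zxx'; have [_|_] := leP (f x y) (g x y).
- by have [y' Zyy' le] := gg' _ _ y Zxx'; exists y'; rewrite // le_max le orbT.
- by have [y' Zyy' le] := ff' _ _ y Zxx'; exists y'; rewrite // le_max le.
Qed.

Lemma simulates_const (p : R) :
  (forall x x' y, Z x x' -> exists y', Z y y') ->
  simulates (fun _ _ => p) (fun _ _ => p).
Proof. by move=> Ztot x x' y /Ztot-/(_ y)[y' Zyy']; exists y'. Qed.

(** On the diagonal [x'] itself is the answer; off it the value is 0 and any point related to [y]
    will do. *)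
Lemma simulates_test (c : T -> R) (c' : T' -> R) :
  (forall x x' y, Z x x' -> exists y', Z y y') ->
  (forall x, 0 <= c' x) -> (forall x x', Z x x' -> c x <= c' x') ->
  simulates (fun x y => if `[< x = y >] then c x else 0)
            (fun x y => if `[< x = y >] then c' x else 0).
Proof.
move=> Ztot c'0 cc' x x' y Zxx'.
case: asboolP => [<-|_]; first by exists x' => //; rewrite asboolT// cc'.
by have [y' Zyy'] := Ztot _ _ y Zxx'; exists y' => //; case: ifP.
Qed.

(** Here the supremum need not be attained: each value is bounded separately, and [y'] may vary with
    [y]. *)
Lemma ex_set_sup_le (f : T -> T -> R) (f' : T' -> T' -> R)
    (c : T -> R) (c' : T' -> R) x x' :
  (forall y, c' y <= 1) -> (forall y y', Z y y' -> c y <= c' y') ->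
  simulates f f' -> Z x x' -> sup (ex_set f c x) <= sup (ex_set f' c' x').
Proof.
move=> c'1 cc' ff' Zxx'; apply: ge_sup; first exact: ex_set_nonempty.
move=> _ [y ->]; have [y' Zyy' fy] := ff' _ _ y Zxx'.
apply: (@le_trans _ _ (Num.min (f' x' y') (c' y'))); first exact: le_min2 (cc' _ _ _).
apply: ub_le_sup; last by exists y'.
by exists 1 => _ [w ->]; rewrite ge_min c'1 orbT.
Qed.

(** The order is reversed since implication is antitone in the role: the matching [y'] has a larger
    role value and a concept value that is no larger. *)
Lemma all_set_inf_le (f : T -> T -> R) (f' : T' -> T' -> R)
    (c : T -> R) (c' : T' -> R) x x' :
  (forall y, 0 <= c' y <= 1) -> (forall y y', Z y y' -> c' y' <= c y) ->
  simulates f f' -> Z x x' -> inf (all_set f' c' x') <= inf (all_set f c x).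
Proof.
move=> c'01 cc' ff' Zxx'; apply: lb_le_inf; first exact: all_set_nonempty.
move=> _ [y ->]; have [y' Zyy' fy] := ff' _ _ y Zxx'.
have c'1 w : c' w <= 1 by case/andP: (c'01 w).
apply: (@le_trans _ _ (godel_imp (f' x' y') (c' y'))).
  apply: ge_inf; last by exists y'.
  by exists 0 => _ [w ->]; rewrite godel_imp_ge0//; case/andP: (c'01 w).
by apply: godel_imp_le; rewrite ?cc'.
Qed.

End Simulation.

(** * Number restrictions *)

Section Counting.
Context {R : realType} {T T' : Type}.
Variables (n : nat) (f : T -> T -> R) (c : T -> R) (x : T).
Variables (f' : T' -> T' -> R) (c' : T' -> R) (x' : T').
Hypotheses (f'01 : forall y z, 0 <= f' y z <= 1) (c'01 : forall y, 0 <= c' y <= 1).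

(** The one fact about tuples that both kinds of number restriction need. Positivity is assumed
    because the counting clauses of a bisimulation speak only of positive role values. *)
Definition count_le : Prop := forall y : 'I_n -> T, injective y ->
  0 < \big[Num.min/1]_(i < n) Num.min (f x (y i)) (c (y i)) ->
  exists2 y' : 'I_n -> T', injective y' &
    \big[Num.min/1]_(i < n) Num.min (f x (y i)) (c (y i)) <=
    \big[Num.min/1]_(i < n) Num.min (f' x' (y' i)) (c' (y' i)).

Lemma ge_set_sup_le : count_le -> sup (ge_set n f c x) <= sup (ge_set n f' c' x').
Proof.
move=> cnt.
have sup0' : 0 <= sup (ge_set n f' c' x').
  have ge01 v : ge_set n f' c' x' v -> 0 <= v <= 1 by exact: ge_set_itv01.
  by case/andP: (sup_itv01 ge01).
(* The set is empty when the domain has fewer than [n] elements. *)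
have [->|/set0P ne] := eqVneq (ge_set n f c x) set0; first by rewrite sup0.
apply: ge_sup => // _ [y y_inj ->]; set v := \big[_/_]_(_ < _) _.
have [v_gt0|v_le0] := ltP 0 v; last exact: le_trans v_le0 sup0'.
have [y' y'_inj le] := cnt y y_inj v_gt0; apply: (le_trans le).
apply: ub_le_sup; last by exists y'.
by exists 1 => _ [w _ ->]; exact: bigmin_le_id.
Qed.

(* Only pairwise distinct tuples of positive value matter: all the others
   contribute 1 to the infimum, and these contribute 0. *)
Lemma lt_set_inf_le : count_le -> inf (lt_set n f' c' x') <= inf (lt_set n f c x).
Proof.
move=> cnt; have lt01 v : lt_set n f' c' x' v -> 0 <= v <= 1 by exact: lt_set_itv01.
have /andP[_ inf1] := inf_itv01 (lt_set_nonempty n f' c' x') lt01.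
apply: lb_le_inf; first exact: lt_set_nonempty.
move=> _ [y ->]; set v := \big[_/_]_(_ < _) _.
case: asboolP => [_|y_distinct]; first by rewrite /godel_imp bigmin_le_id.
have [v_gt0|v_le0] := ltP 0 v; last by rewrite /godel_imp v_le0.
have y_inj : injective y.
  move=> j k yjk; apply/val_inj/eqP; apply: contrapT => /negP.
  rewrite neq_ltn => /orP[jk|kj]; apply: y_distinct.
    by exists j, k.
  by exists k, j.
have [y' y'_inj le] := cnt y y_inj v_gt0.
rewrite [leRHS]/godel_imp [v <= 0]leNgt v_gt0 /=.
apply: ge_inf; first by exists 0 => w /lt01/andP[].
exists y'; rewrite asboolF; last by case=> j [k [jk /y'_inj ejk]]; rewrite ejk ltnn in jk.
by rewrite /godel_imp leNgt (lt_le_trans v_gt0 le).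
Qed.

End Counting.

(** * Invariance under crisp bisimulations *)

Section Bisimulation.
Context {R : realType} {CN RN IN : Type} {Phi : set feature}.

(** Forth and back clauses trade places, so each later fact about one direction also yields the
    other. *)
Lemma crisp_bisim_sym (I I' : interp R CN RN IN) (Z : dom I -> dom I' -> bool) :
  crisp_bisim Phi Z -> crisp_bisim Phi (fun x' x => Z x x').
Proof.
case=> cname forth back nominal uforth uback self Qforth Qback Nforth Nback.
split.
- by move=> x' x A; rewrite godel_iffC.
- by move=> x' x; exact: back.
- by move=> x' x; exact: forth.
- by move=> h x' x a [] [? ?]; apply: (nominal h _ _ a); [right|left].
- by move=> h x' x; exact: (uback h).
- by move=> h x' x; exact: (uforth h).
- by move=> h x' x r; rewrite godel_iffC; exact: (self h).
- by move=> n n_gt0 h x' x; exact: (Qback _ _ h).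
- by move=> n n_gt0 h x' x; exact: (Qforth _ _ h).
- by move=> n n_gt0 h x' x; exact: (Nback _ _ h).
- by move=> n n_gt0 h x' x; exact: (Nforth _ _ h).
Qed.

Section OneDirection.
Context {I I' : interp R CN RN IN} {Z : dom I -> dom I' -> bool}.
Hypothesis hZ : crisp_bisim Phi Z.

(** Decodes the numeric bisimulation clauses: a false [b] would make the minimum at most 0. *)
Lemma le_min_bool_gt0 (b : bool) (p q r : R) :
  0 < p -> p <= Num.min b%:R q -> b /\ p <= q.
Proof.
by case: b => p0; rewrite le_min => /andP[pb pq]//; move: p0; rewrite ltNge pb.
Qed.

Lemma bisim_total : Phi FU -> forall x x' y, Z x x' -> exists y', Z y y'.
Proof.
move=> hU x x' y Zxx'; have [y'] := bisim_univ_forth hZ hU x x' y.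
by rewrite Zxx' ler1n lt0b => Zyy'; exists y'.
Qed.

Lemma bisim_basic : Phi FU -> forall B : basic_role RN Phi,
  simulates Z (basic_interp B) (basic_interp B).
Proof.
move=> hU B x x' y Zxx'.
have /andP[B0 B1] := basic_interp_itv01 B x y.
have [B_gt0|B_le0] := ltP 0 (basic_interp B x y).
  have [y'] := bisim_forth hZ x x' B y.
  by rewrite Zxx' min_r// => /(le_min_bool_gt0 0 B_gt0)[Zyy' le]; exists y'.
(* At value 0 the forth clause gives no related point, so the universal role has to. *)
have [y' Zyy'] := bisim_total hU y Zxx'; exists y' => //.
by apply: (le_trans B_le0); case/andP: (basic_interp_itv01 B x' y').
Qed.

Lemma bisim_name x x' (A : CN) : Z x x' ->
  (cname_interp A x)%:num = (cname_interp A x')%:num :> R.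
Proof.
move=> Zxx'; apply: godel_iff_eq; [exact: le1|exact: le1|].
by have := bisim_cname hZ x x' A; rewrite Zxx'.
Qed.

Lemma bisim_self_eq x x' (r : RN) : Phi FSelf -> Z x x' ->
  (rname_interp r x x)%:num = (rname_interp r x' x')%:num :> R.
Proof.
move=> h Zxx'; apply: godel_iff_eq; [exact: le1|exact: le1|].
by have := bisim_self hZ h x x' r; rewrite Zxx'.
Qed.

(** The point [y' i] is related to some [y j], with no control over [j]. This suffices: every
    [c (y j)] is at least the minimum [v]. *)
Lemma bisim_count_le_Q (n : nat) (n_gt0 : (0 < n)%N) (B : basic_role RN Phi)
    (c : dom I -> R) (c' : dom I' -> R) x x' :
  Phi (FQ n_gt0) -> (forall y y', Z y y' -> c y <= c' y') -> Z x x' ->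
  count_le n (basic_interp B) c x (basic_interp B) c' x'.
Proof.
move=> h cc' Zxx' y y_inj; set v := \big[_/_]_(_ < _) _ => v_gt0.
have vP i : v <= basic_interp B x (y i) /\ v <= c (y i).
  by apply/andP; rewrite -le_min; exact: bigmin_le.
have B_gt0 j : 0 < basic_interp B x (y j) by apply: lt_le_trans v_gt0 (vP j).1.
have Z_gt0 : 0 < (Z x x')%:R :> R by rewrite Zxx'.
have [y' y'_inj y'P] := bisim_Q_forth hZ h Z_gt0 y_inj B_gt0.
exists y' => //; rewrite le_bigmin ?bigmin_le_id// => i _.
have [j] := y'P i; rewrite Zxx' => le.
have vm : v <= Num.min 1 (\big[Num.min/1]_(k < n) basic_interp B x (y k)).
  rewrite le_min bigmin_le_id le_bigmin ?bigmin_le_id// => k _; exact: (vP k).1.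
have [Zy le'] := le_min_bool_gt0 0 v_gt0 (le_trans vm le).
by rewrite le_min le' (le_trans (vP j).2)// cc'.
Qed.

(** The concept is constantly 1, so nothing is transported along [Z] and the weaker clause for
    unqualified restrictions is enough. *)
Lemma bisim_count_le_N (n : nat) (n_gt0 : (0 < n)%N) (B : basic_role RN Phi) x x' :
  Phi (FN n_gt0) -> Z x x' ->
  count_le n (basic_interp B) (fun=> 1) x (basic_interp B) (fun=> 1 : R) x'.
Proof.
move=> h Zxx' y y_inj; set v := \big[_/_]_(_ < _) _ => v_gt0.
have vP i : v <= basic_interp B x (y i).
  have := bigmin_le 1 i (fun i => Num.min (basic_interp B x (y i)) 1).
  by rewrite le_min => /andP[].
have B_gt0 j : 0 < basic_interp B x (y j) by apply: lt_le_trans v_gt0 (vP j).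
have Z_gt0 : 0 < (Z x x')%:R :> R by rewrite Zxx'.
have [y' y'_inj y'P] := bisim_N_forth hZ h Z_gt0 y_inj B_gt0.
exists y' => //; rewrite le_bigmin ?bigmin_le_id// => i _.
rewrite le_min bigmin_le_id andbT (le_trans _ (y'P i))// Zxx'.
by rewrite le_min bigmin_le_id le_bigmin ?bigmin_le_id.
Qed.

End OneDirection.

Definition bisimulates {T T' : Type} (Z : T -> T' -> bool)
    (f : T -> T -> R) (f' : T' -> T' -> R) : Prop :=
  simulates Z f f' /\ simulates (fun x' x => Z x x') f' f.

Lemma bisimulation_invariance (I I' : interp R CN RN IN)
    (Z : dom I -> dom I' -> bool) :
  Phi FU -> witnessed Phi I -> witnessed Phi I' -> crisp_bisim Phi Z ->
  (forall P : role R CN RN IN Phi,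
     bisimulates Z (role_interp P) (role_interp P) /\
     (Phi FI -> bisimulates Z (conv (role_interp P)) (conv (role_interp P)))) /\
  (forall (C : concept R CN RN IN Phi) x x', Z x x' ->
     concept_interp C x = concept_interp C x').
Proof.
move=> hU hI hI' hZ; have hZ' := crisp_bisim_sym hZ.
have tot := bisim_total hZ hU; have tot' := bisim_total hZ' hU.
have r01 := @role_interp_itv01 R CN RN IN Phi.
have c01 := @concept_interp_itv01 R CN RN IN Phi.
have c1 (J : interp R CN RN IN) (C : concept R CN RN IN Phi) (x : dom J) :
  concept_interp C x <= 1 by case/andP: (c01 J C x).
have c0 (J : interp R CN RN IN) (C : concept R CN RN IN Phi) (x : dom J) :
  0 <= concept_interp C x by case/andP: (c01 J C x).
apply: role_concept_ind => /=.
- move=> r; split.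
    by split; [exact: (bisim_basic hZ hU (BName _ r))
             |exact: (bisim_basic hZ' hU (BName _ r))].
  by move=> h; split; [exact: (bisim_basic hZ hU (BInv h r))
                      |exact: (bisim_basic hZ' hU (BInv h r))].
- move=> P [[PP PP'] IHP] Q [[QQ QQ'] IHQ]; split.
    by split; apply: simulates_comp => // x y; exact: witnessed_comp.
  move=> h; have [P1 P2] := IHP h; have [Q1 Q2] := IHQ h.
  (* The converse of a composition composes the converses in reverse order, over the same value set,
     so the witness condition carries over. *)
  have convE (J : interp R CN RN IN) :
    conv (fun x y : dom J => sup (comp_set (role_interp P) (role_interp Q) x y))
    = fun x y => sup (comp_set (conv (role_interp Q)) (conv (role_interp P)) x y).
    by apply/funext => x; apply/funext => y; rewrite /conv comp_set_conv.
  rewrite !convE.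
  split; apply: simulates_comp => // x y; try exact: r01;
    by rewrite -comp_set_conv; exact: witnessed_comp.
- move=> P [[PP PP'] IHP] Q [[QQ QQ'] IHQ]; split.
    by split; exact: simulates_max.
  move=> h; have [P1 P2] := IHP h; have [Q1 Q2] := IHQ h.
  by split; [exact: simulates_max P1 Q1 | exact: simulates_max P2 Q2].
- move=> P [[PP PP'] IHP]; split.
    by split; apply: simulates_star => // x y; exact: witnessed_star.
  move=> h; have [P1 P2] := IHP h.
  have convE (J : interp R CN RN IN) :
    conv (fun x y : dom J => sup (star_set (role_interp P) x y))
    = fun x y => sup (star_set (conv (role_interp P)) x y).
    by apply/funext => x; apply/funext => y; rewrite /conv star_set_conv.
  rewrite !convE.
  split; apply: simulates_star => // x y; rewrite -star_set_conv;
    exact: witnessed_star.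
- move=> C IHC.
  have test : bisimulates Z (fun x y => if `[< x = y >] then concept_interp C x else 0)
                            (fun x y => if `[< x = y >] then concept_interp C x else 0).
    by split; apply: simulates_test => // x x' /IHC->.
  by split=> // _; rewrite !test_conv.
(* Inversion exchanges the two halves of the induction hypothesis; the constructor itself carries
   the proof of [Phi FI]. *)
- by move=> h P [PP IHP]; split=> [|_]; [exact: IHP h|exact: PP].
- move=> h; have U : bisimulates Z (fun _ _ => 1) (fun _ _ => 1).
    by split; exact: simulates_const.
  by split.
- by [].
- by move=> A x x' Zxx'; exact: (bisim_name hZ).
- by move=> C IHC D IHD x x' Zxx'; rewrite (IHC _ _ Zxx') (IHD _ _ Zxx').
- by move=> C IHC D IHD x x' Zxx'; rewrite (IHC _ _ Zxx') (IHD _ _ Zxx').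
- by move=> C IHC x x' Zxx'; rewrite (IHC _ _ Zxx').
- by move=> C IHC D IHD x x' Zxx'; rewrite (IHC _ _ Zxx') (IHD _ _ Zxx').
- by move=> C IHC x x' Zxx'; rewrite (IHC _ _ Zxx').
(* By antitonicity the backward simulation gives the first inequality and the forward one the
   second. *)
- move=> P [[PP PP'] _] C IHC x x' Zxx'; apply/le_anti/andP; split.
    by apply: (all_set_inf_le _ _ PP') => // y y' /IHC->.
  by apply: (all_set_inf_le _ _ PP) => // y y' /IHC->.
- move=> P [[PP PP'] _] C IHC x x' Zxx'; apply/le_anti/andP; split.
    by apply: (ex_set_sup_le _ _ PP) => // y y' /IHC->.
  by apply: (ex_set_sup_le _ _ PP') => // y y' /IHC->.
- move=> h a x x' Zxx'; have no := bisim_nominal hZ h (x := x) (x' := x') (a := a).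
  case: asboolP => xa; case: asboolP => x'a //.
    by rewrite no in Zxx'; [|left].
  by rewrite no in Zxx'; [|right].
- by move=> h r x x' Zxx'; exact: (bisim_self_eq hZ).
- move=> n n_gt0 h B C IHC x x' Zxx'; apply/le_anti/andP; split;
    apply: ge_set_sup_le => //; try exact: basic_interp_itv01.
    by apply: (bisim_count_le_Q hZ h) => // y y' /IHC->.
  by apply: (bisim_count_le_Q hZ' h) => // y y' /IHC->.
- move=> n n_gt0 h B C IHC x x' Zxx'; apply/le_anti/andP; split;
    apply: lt_set_inf_le => //.
    by apply: (bisim_count_le_Q hZ' h) => // y y' /IHC->.
  by apply: (bisim_count_le_Q hZ h) => // y y' /IHC->.
- move=> n n_gt0 h B x x' Zxx'.
  apply/le_anti/andP; split; apply: ge_set_sup_le => [y z|y|];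
    try exact: basic_interp_itv01; rewrite ?ler01 ?lexx//.
    exact: (bisim_count_le_N hZ h).
  exact: (bisim_count_le_N hZ' h).
- move=> n n_gt0 h B x x' Zxx'.
  apply/le_anti/andP; split; apply: lt_set_inf_le => //.
    exact: (bisim_count_le_N hZ' h).
  exact: (bisim_count_le_N hZ h).
Qed.

Lemma tbox_holds_bisim (I I' : interp R CN RN IN) (Tb : set (gci R CN RN IN Phi)) :
  Phi FU -> witnessed Phi I -> witnessed Phi I' -> strongly_bisimilar Phi I I' ->
  tbox_holds I Tb -> tbox_holds I' Tb.
Proof.
move=> hU hI hI' [[a] [Z [hZ Za]]] IT g /IT Ig x'.
have [x Zxx'] := bisim_total (crisp_bisim_sym hZ) hU x' (Za a).
(* The implication between the two sides is itself a concept, so its value is transferred whole,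
   whichever threshold is used. *)
rewrite -((bisimulation_invariance hU hI hI' hZ).2 _ _ _ Zxx').
exact: Ig.
Qed.

Lemma strongly_bisimilar_sym (I I' : interp R CN RN IN) :
  strongly_bisimilar Phi I I' -> strongly_bisimilar Phi I' I.
Proof.
move=> [inh [Z [hZ Za]]]; split=> //.
by exists (fun x' x => Z x x'); split; first exact: crisp_bisim_sym.
Qed.

End Bisimulation.

Theorem theorem6 (R : realType) (CN RN IN : Type) (Phi : set feature)
    (hU : Phi FU) (Tb : set (gci R CN RN IN Phi)) (hTb : finite_set Tb)
    (I I' : interp R CN RN IN)
    (hI : witnessed Phi I) (hI' : witnessed Phi I')
    (hII' : strongly_bisimilar Phi I I') :
  tbox_holds I Tb <-> tbox_holds I' Tb.
Proof.
split; apply: tbox_holds_bisim => //.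
exact: strongly_bisimilar_sym.
Qed.
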